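(* Let $(A,[\cdot,\cdot],\cdot)$ be an almost Poisson algebra, let $\Delta,\delta:A\to A\otimes A$ be linear maps, and suppose that $A^*$ with product $\Delta^*:A^*\otimes A^*\to A^*$ and bracket $\delta^*:A^*\otimes A^*\to A^*$ (the transposes of $\Delta$ and $\delta$) is an almost Poisson algebra. Then the following are equivalent: (1) $(A,[\cdot,\cdot],\cdot,\Delta,\delta)$ is an almost Poisson $D$-bialgebra; (2) $(A,A^*,\mathrm{ad}_A^*,-L^*,\mathrm{ad}_{A^*}^*,-L_{A^*}^* )$ is a matched pair of almost Poisson algebras; (3) $(A\oplus A^*,A,A^* )$ is a standard Manin triple of almost Poisson algebras with respect to $\omega_d(x+\xi,y+\eta)=\langle x,\eta\rangle+\langle\xi,y\rangle$ ($x,y\in A$, $\xi,\eta\in A^*$).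
   Context: All vector spaces are finite dimensional over a field $\mathbb{K}$ of characteristic zero; $\langle\cdot,\cdot\rangle$ is the canonical pairing between a space and its dual; $\tau(a\otimes b)=b\otimes a$. An almost Poisson algebra $(A,[\cdot,\cdot],\cdot)$ is a vector space with a commutative associative bilinear product $\cdot$ and a skew-symmetric bilinear bracket satisfying $[x,y\cdot z]=[x,y]\cdot z+y\cdot[x,z]$ (no Jacobi identity is assumed). Write $L(x)y=x\cdot y$, $\mathrm{ad}(x)y=\mathrm{ad}_A(x)y=[x,y]$. A cocommutative coassociative coalgebra is $(C,\Delta)$ with $\tau\circ\Delta=\Delta$ and $(\mathrm{id}\otimes\Delta)\Delta=(\Delta\otimes\mathrm{id})\Delta$. An almost Poisson coalgebra is $(C,\Delta,\delta)$, with $(C,\Delta)$ a cocommutative coassociative coalgebra and $\delta:C\to C\otimes C$ linear with $\tau\circ\delta=-\delta$ and $(\mathrm{id}\otimes\Delta)\delta-(\delta\otimes\mathrm{id})\Delta-(\tau\otimes\mathrm{id})(\mathrm{id}\otimes\delta)\Delta=0$. An almost Poisson $D$-bialgebra is $(A,[\cdot,\cdot],\cdot,\Delta,\delta)$ such that $(A,[\cdot,\cdot],\cdot)$ is an almost Poisson algebra, $(A,\Delta,\delta)$ is an almost Poisson coalgebra, and for all $x,y\in A$: $$\Delta(x\cdot y)=(L(x)\otimes\mathrm{id})\Delta(y)+(\mathrm{id}\otimes L(y))\Delta(x),$$ $$\delta(x\cdot y)+(\mathrm{ad}(y)\otimes\mathrm{id})\Delta(x)-(\mathrm{id}\otimes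 L(x))\delta(y)+(\mathrm{ad}(x)\otimes\mathrm{id})\Delta(y)-(\mathrm{id}\otimes L(y))\delta(x)=0,$$ $$\Delta([x,y])-(L(y)\otimes\mathrm{id})\delta(x)-(\mathrm{id}\otimes\mathrm{ad}(x))\Delta(y)+(\mathrm{id}\otimes L(y))\delta(x)-(\mathrm{ad}(x)\otimes\mathrm{id})\Delta(y)=0.$$ A representation of a commutative associative algebra $(A,\cdot)$ is $(V,\mu)$ with $\mu:A\to\mathrm{End}(V)$ linear and $\mu(x\cdot y)=\mu(x)\mu(y)$. A representation of an almost Poisson algebra is $(V,\varrho,\mu)$ with $\varrho,\mu:A\to\mathrm{End}(V)$ linear, $(V,\mu)$ a representation of $(A,\cdot)$, $\varrho(x\cdot y)=\mu(y)\varrho(x)+\mu(x)\varrho(y)$ and $\mu([x,y])=\varrho(x)\mu(y)-\mu(y)\varrho(x)$. For linear $\theta:A\to\mathrm{End}(V)$, the dual map $\theta^*:A\to\mathrm{End}(V^* )$ is $\langle\theta^*(x)\xi,v\rangle=-\langle\xi,\theta(x)v\rangle$. Thus $\mathrm{ad}_A^*,L^*:A\to\mathrm{End}(A^* )$; and $\mathrm{ad}_{A^*}$, $L_{A^*}$ denote the adjoint map and left multiplication of the almost Poisson algebra $A^*$, so that $\mathrm{ad}_{A^*}^*,L_{A^*}^*:A^*\to\mathrm{End}(A)$ (identifying $A^{**}=A$). Matched pair of commutative associative algebras: $(A_1,A_2,\mu_1,\mu_2)$ where $(A_i,\cdot_i)$ are commutative associative algebras, $\mu_1:A_1\to\mathrm{End}(A_2)$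 and $\mu_2:A_2\to\mathrm{End}(A_1)$ are representations of $A_1$ and $A_2$ respectively, and for all $x_1,y_1\in A_1$, $x_2,y_2\in A_2$: $$\mu_1(x_1)(x_2\cdot_2y_2)=(\mu_1(x_1)x_2)\cdot_2y_2+\mu_1(\mu_2(x_2)x_1)y_2,$$ $$\mu_2(x_2)(x_1\cdot_1y_1)=(\mu_2(x_2)x_1)\cdot_1y_1+\mu_2(\mu_1(x_1)x_2)y_1.$$ Matched pair of almost Poisson algebras: $(A_1,A_2,\varrho_1,\mu_1,\varrho_2,\mu_2)$ where $(A_i,[\cdot,\cdot]_i,\cdot_i)$ are almost Poisson algebras, $\varrho_1,\mu_1:A_1\to\mathrm{End}(A_2)$ and $\varrho_2,\mu_2:A_2\to\mathrm{End}(A_1)$ are linear, $(A_1,A_2,\mu_1,\mu_2)$ is a matched pair of commutative associative algebras, $(A_2,\varrho_1,\mu_1)$ and $(A_1,\varrho_2,\mu_2)$ are representations of the almost Poisson algebras $A_1$ and $A_2$ respectively, and for all $x_1,y_1\in A_1$, $x_2,y_2\in A_2$: $$\varrho_2(x_2)(x_1\cdot_1y_1)=(\varrho_2(x_2)x_1)\cdot_1y_1+x_1\cdot_1(\varrho_2(x_2)y_1)-\mu_2(\varrho_1(x_1)x_2)y_1-\mu_2(\varrho_1(y_1)x_2)x_1,$$ $$\varrho_1(x_1)(x_2\cdot_2y_2)=(\varrho_1(x_1)x_2)\cdot_2y_2+x_2\cdot_2(\varrho_1(x_1)y_2)-\mu_1(\varrho_2(x_2)x_1)y_2-\mu_1(\varrho_2(y_2)x_1)x_2,$$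 $$[x_1,\mu_2(x_2)y_1]_1-\varrho_2(\mu_1(y_1)x_2)x_1=\mu_2(\varrho_1(x_1)x_2)y_1-(\varrho_2(x_2)x_1)\cdot_1y_1+\mu_2(x_2)[x_1,y_1]_1,$$ $$[x_2,\mu_1(x_1)y_2]_2-\varrho_1(\mu_2(y_2)x_1)x_2=\mu_1(\varrho_2(x_2)x_1)y_2-(\varrho_1(x_1)x_2)\cdot_2y_2+\mu_1(x_1)[x_2,y_2]_2.$$ A Manin triple of almost Poisson algebras $(P,P^+,P^-)$ consists of an almost Poisson algebra $P$ and almost Poisson algebras $P^+,P^-$ together with a nondegenerate symmetric bilinear form $\omega$ on $P$ that is invariant, i.e. $\omega(x\cdot y,z)=\omega(x,y\cdot z)$ and $\omega([x,y],z)=\omega(x,[y,z])$, such that $P^\pm$ are almost Poisson subalgebras of $P$, $P=P^+\oplus P^-$ as vector spaces, and $P^+,P^-$ are isotropic for $\omega$. The triple $(A\oplus A^*,A,A^* )$ is a standard Manin triple if there is an almost Poisson algebra structure on $A\oplus A^*$, having the given almost Poisson algebras $A$ and $A^*$ as subalgebras, such that $(A\oplus A^*,A,A^* )$ is a Manin triple with respect to $\omega_d$. *)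

(* Defs.v *)
From HB Require Import structures.
From mathcomp Require Import all_boot all_order all_algebra.

Set Implicit Arguments.
Unset Strict Implicit.
Unset Printing Implicit Defensive.

Import GRing.Theory.
Local Open Scope ring_scope.

Lemma linfunE (K : fieldType) (U V : vectType K) (f : U -> V) :
  linear f -> linfun f =1 f.
Proof.
move=> lin_f u.
pose fA := GRing.isLinear.Build K U V *:%R f lin_f.
pose F : {linear U -> V} := HB.pack f fA.
exact: (lfunE F u).
Qed.

Section TensorProduct.
Variable K : fieldType.
Implicit Types U V W : vectType K.

(* The library has no tensor product of vector spaces: an element of U (x) V  *)
(* is encoded by its coordinates on the products of the vectors of the        *)
(* library's bases of U and V.  Lemmas tliftE and tensorP state its universal *)
(* property; everything below only uses pure tensors and tlift.               *)
Definition tensor U V : vectType K := 'M[K]_(\dim {:U}, \dim {:V}).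

Definition tens U V (u : U) (v : V) : tensor U V :=
  \matrix_(i, j) (coord (vbasis {:U}) i u * coord (vbasis {:V}) j v).

Definition tlift U V W (beta : U -> V -> W) : 'Hom(tensor U V, W) :=
  linfun (fun t : tensor U V => \sum_i \sum_j
    (t : 'M_(_, _)) i j *: beta (vbasis {:U})`_i (vbasis {:V})`_j).

Definition tmap U V U' V' (f : 'Hom(U, U')) (g : 'Hom(V, V')) :
    'Hom(tensor U V, tensor U' V') :=
  tlift (fun u v => tens (f u) (g v)).

Definition tswap U V : 'Hom(tensor U V, tensor V U) :=
  tlift (fun u v => tens v u).

Definition tassoc U V W :
    'Hom(tensor U (tensor V W), tensor (tensor U V) W) :=
  tlift (fun u => tlift (fun v w => tens (tens u v) w)).

End TensorProduct.

Notation "U ⊗ V" := (tensor U V) (at level 40, left associativity).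
Notation "f \ox g" := (tmap f g) (at level 40, left associativity).

Section TensorProductTheory.
Variable K : fieldType.
Implicit Types U V W : vectType K.

Lemma tensDl U V (v : V) : linear (fun u : U => tens u v).
Proof.
move=> a u u'; apply/matrixP=> i j.
by rewrite !mxE linearP mulrDl mulrA.
Qed.

Lemma tensDr U V (u : U) : linear (fun v : V => tens u v).
Proof.
move=> a v v'; apply/matrixP=> i j.
by rewrite !mxE linearP mulrDr mulrCA.
Qed.

Let linear_coord U V (f : U -> V) u : linear f ->
  f u = \sum_i coord (vbasis {:U}) i u *: f (vbasis {:U})`_i.
Proof.
move=> lin_f; rewrite -(linfunE lin_f) {1}(coord_vbasis (memvf u)) linear_sum.
by apply: eq_bigr => i _; rewrite linearZ /= linfunE.
Qed.

Let tlift_fun_linear U V W (beta : U -> V -> W) :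
  linear (fun t : U ⊗ V => \sum_i \sum_j
    (t : 'M_(_, _)) i j *: beta (vbasis {:U})`_i (vbasis {:V})`_j).
Proof.
move=> a s t; rewrite scaler_sumr -big_split /=; apply: eq_bigr => i _.
rewrite scaler_sumr -big_split /=; apply: eq_bigr => j _.
by rewrite !mxE scalerDl scalerA.
Qed.

Lemma tliftE U V W (beta : U -> V -> W) u v :
    (forall u, linear (beta u)) -> (forall v, linear (beta^~ v)) ->
  tlift beta (tens u v) = beta u v.
Proof.
move=> linr linl; rewrite /tlift (linfunE (tlift_fun_linear beta)).
rewrite [RHS](linear_coord u (linl v)); apply: eq_bigr => i _.
rewrite [beta _ v](linear_coord v (linr _)) scaler_sumr.
by apply: eq_bigr => j _; rewrite mxE scalerA.
Qed.

Lemma tensorP U V W (f g : 'Hom(U ⊗ V, W)) :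
  (forall u v, f (tens u v) = g (tens u v)) -> f = g.
Proof.
move=> eq_fg; apply/lfunP=> t.
suff -> : t = \sum_i \sum_j (t : 'M_(_, _)) i j *:
               tens (vbasis {:U})`_i (vbasis {:V})`_j.
  rewrite !linear_sum; apply: eq_bigr => i _.
  by rewrite !linear_sum; apply: eq_bigr => j _; rewrite !linearZ /= eq_fg.
rewrite [LHS](matrix_sum_delta (t : 'M_(_, _))).
apply: eq_bigr => i _; apply: eq_bigr => j _; congr (_ *: _).
apply/matrixP=> k l; rewrite !mxE !coord_free ?(basis_free (vbasisP _)) //.
by rewrite -natrM mulnb (eq_sym k) (eq_sym l).
Qed.

Lemma tmapE U V U' V' (f : 'Hom(U, U')) (g : 'Hom(V, V')) u v :
  (f \ox g) (tens u v) = tens (f u) (g v).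
Proof.
rewrite /tmap tliftE // => w a x y.
  by rewrite linearP tensDr.
by rewrite linearP tensDl.
Qed.

Lemma tswapE U V (u : U) (v : V) : tswap U V (tens u v) = tens v u.
Proof. by rewrite /tswap tliftE // => w; [apply: tensDl | apply: tensDr]. Qed.

Lemma tassocE U V W (u : U) (v : V) (w : W) :
  tassoc U V W (tens u (tens v w)) = tens (tens u v) w.
Proof.
have linv x w' : linear (fun v' : V => tens (tens x v') w').
  by move=> a y y'; rewrite (tensDr x) (tensDl w').
have linu y w' : linear (fun x : U => tens (tens x y) w').
  by move=> a x x'; rewrite (tensDl y) (tensDl w').
have inner (x : U) (y : V) (z : W) :
    tlift (fun (v : V) (w : W) => tens (tens x v) w) (tens y z)
    = tens (tens x y) z.
  rewrite (@tliftE V W _ (fun (v : V) (w : W) => tens (tens x v) w)) // => y'.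
  exact: tensDr.
rewrite /tassoc tliftE ?inner // => [x|t].
  by move=> a y y'; rewrite linearP.
move=> a x x' /=; rewrite -scale_lfunE -add_lfunE; congr (fun_of_lfun _ t).
by apply/tensorP=> y z; rewrite add_lfunE scale_lfunE !inner linu.
Qed.

End TensorProductTheory.

Section Duality.
Variable K : fieldType.
Implicit Types U V B : vectType K.

Definition dual V : vectType K := 'Hom(V, K^o).

Definition dtens U V (xi : dual U) (eta : dual V) : dual (U ⊗ V) :=
  tlift (fun u v => (xi u * eta v : K^o)).

Definition dual_rep B V (theta : 'Hom(B, 'End(V))) : 'Hom(B, 'End(dual V)) :=
  linfun (fun b => linfun (fun xi : dual V => (- (xi \o theta b)%VF : dual V))).

Definition bidual V : 'Hom(V, dual (dual V)) :=
  linfun (fun v => linfun (fun xi : dual V => (xi v : K^o))).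

(* The dual map of theta : B -> End(V^* ), read in End(V) instead of          *)
(* End(V^** ) through the isomorphism bidual; see codual_repE.                *)
Definition codual_rep B V (theta : 'Hom(B, 'End(dual V))) : 'Hom(B, 'End(V)) :=
  linfun (fun b => ((bidual V)^-1 \o dual_rep theta b \o bidual V)%VF).

Lemma dtensE U V (xi : dual U) (eta : dual V) u v :
  dtens xi eta (tens u v) = xi u * eta v.
Proof.
rewrite /dtens tliftE // => w a x y; rewrite linearP.
  by rewrite mulrDr -scalerAr.
by rewrite mulrDl -scalerAl.
Qed.

Lemma dual_repE B V (theta : 'Hom(B, 'End(V))) b (xi : dual V) v :
  dual_rep theta b xi v = - xi (theta b v).
Proof.
have inner c : linear (fun xi : dual V => (- (xi \o theta c)%VF : dual V)).
  move=> a f g; apply/lfunP=> w.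
  by rewrite !(opp_lfunE, add_lfunE, scale_lfunE, comp_lfunE) scalerN opprD.
rewrite /dual_rep linfunE; last first.
  move=> a c d; apply/lfunP=> f; rewrite !(add_lfunE, scale_lfunE) !linfunE //.
  apply/lfunP=> w.
  rewrite !(opp_lfunE, add_lfunE, scale_lfunE, comp_lfunE).
  by rewrite !linearP /= !(add_lfunE, scale_lfunE) linearP scalerN opprD.
by rewrite linfunE // opp_lfunE comp_lfunE.
Qed.

Lemma bidualE V v (xi : dual V) : bidual V v xi = xi v.
Proof.
have inner w : linear (fun xi : dual V => (xi w : K^o)).
  by move=> a f g; rewrite add_lfunE scale_lfunE.
rewrite /bidual linfunE ?linfunE // => a u w; apply/lfunP=> f.
by rewrite add_lfunE scale_lfunE !linfunE // linearP.
Qed.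

Lemma bidualK V : cancel (bidual V)^-1%VF (bidual V).
Proof.
have ker0 : lker (bidual V) == 0%VS.
  apply/lker0P=> u v eq_uv; rewrite (coord_vbasis (memvf u)).
  rewrite [RHS](coord_vbasis (memvf v)); apply: eq_bigr => i _; congr (_ *: _).
  pose xi : dual V := linfun (coord (vbasis {:V}) i : V -> K^o).
  have := congr1 (fun f : dual (dual V) => f xi) eq_uv.
  by rewrite !bidualE /xi !linfunE // => a x y; rewrite linearP.
move=> f; apply: limg_lfunVK.
suff -> : limg (bidual V) = fullv by rewrite memvf.
apply/eqP; rewrite eqEdim subvf limg_dim_eq; last first.
  by rewrite (eqP ker0) capv0.
rewrite !dimvf.
have dimD W : dim (dual W) = dim W by rewrite {1}/dim /= muln1.
by rewrite !dimD leqnn.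
Qed.

Lemma codual_repE B V (theta : 'Hom(B, 'End(dual V))) b (xi : dual V) v :
  xi (codual_rep theta b v) = - theta b xi v.
Proof.
rewrite /codual_rep linfunE => [|a c d]; last first.
  by rewrite linearP comp_lfunDr comp_lfunDl -comp_lfunZr -comp_lfunZl.
by rewrite -bidualE !comp_lfunE bidualK dual_repE bidualE.
Qed.

End Duality.

Section AlmostPoisson.
Variable K : fieldType.
Implicit Types A V P : vectType K.

(* A bilinear operation on A, curried: for the product mul and the bracket br *)
(* of an algebra, mul x and br x are the operators L(x) and ad(x).            *)
Definition bilin A := 'Hom(A, 'End(A)).

Record comm_assoc_algebra A (mul : bilin A) : Prop := {
  caa_comm : forall x y, mul x y = mul y x;
  caa_assoc : forall x y z, mul (mul x y) z = mul x (mul y z) }.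

Record almost_Poisson_algebra A (br mul : bilin A) : Prop := {
  apa_comm_assoc : comm_assoc_algebra mul;
  apa_skew : forall x y, br x y = - br y x;
  apa_leibniz : forall x y z,
    br x (mul y z) = mul (br x y) z + mul y (br x z) }.

(* Elements of A (x) (A (x) A) are moved to (A (x) A) (x) A by tassoc, an     *)
(* identification that is implicit on paper.                                  *)
Record cocomm_coassoc_coalgebra A (Delta : 'Hom(A, A ⊗ A)) : Prop := {
  ccc_cocomm : forall x, tswap A A (Delta x) = Delta x;
  ccc_coassoc : forall x,
    tassoc A A A ((\1%VF \ox Delta) (Delta x)) = (Delta \ox \1%VF) (Delta x) }.

Record almost_Poisson_coalgebra A (Delta delta : 'Hom(A, A ⊗ A)) : Prop := {
  apc_cocomm_coassoc : cocomm_coassoc_coalgebra Delta;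
  apc_skew : forall x, tswap A A (delta x) = - delta x;
  apc_leibniz : forall x,
    tassoc A A A ((\1%VF \ox Delta) (delta x))
    - (delta \ox \1%VF) (Delta x)
    - (tswap A A \ox \1%VF) (tassoc A A A ((\1%VF \ox delta) (Delta x))) = 0 }.

Record almost_Poisson_D_bialgebra A (br mul : bilin A)
    (Delta delta : 'Hom(A, A ⊗ A)) : Prop := {
  apb_algebra : almost_Poisson_algebra br mul;
  apb_coalgebra : almost_Poisson_coalgebra Delta delta;
  apb_Delta_mul : forall x y,
    Delta (mul x y) = (mul x \ox \1%VF) (Delta y) + (\1%VF \ox mul y) (Delta x);
  apb_delta_mul : forall x y,
    delta (mul x y) + (br y \ox \1%VF) (Delta x)
    - (\1%VF \ox mul x) (delta y) + (br x \ox \1%VF) (Delta y)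
    - (\1%VF \ox mul y) (delta x) = 0;
  apb_Delta_br : forall x y,
    Delta (br x y) - (mul y \ox \1%VF) (delta x)
    - (\1%VF \ox br x) (Delta y) + (\1%VF \ox mul y) (delta x)
    - (br x \ox \1%VF) (Delta y) = 0 }.

Definition comm_assoc_rep A V (mul : bilin A) (mu : 'Hom(A, 'End(V))) : Prop :=
  forall x y v, mu (mul x y) v = mu x (mu y v).

Record almost_Poisson_rep A V (br mul : bilin A)
    (rho mu : 'Hom(A, 'End(V))) : Prop := {
  apr_mul : comm_assoc_rep mul mu;
  apr_rho_mul : forall x y v,
    rho (mul x y) v = mu y (rho x v) + mu x (rho y v);
  apr_mu_br : forall x y v,
    mu (br x y) v = rho x (mu y v) - mu y (rho x v) }.

Record comm_assoc_matched_pair A1 A2 (mul1 : bilin A1) (mul2 : bilin A2)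
    (mu1 : 'Hom(A1, 'End(A2))) (mu2 : 'Hom(A2, 'End(A1))) : Prop := {
  cmp_algebra1 : comm_assoc_algebra mul1;
  cmp_algebra2 : comm_assoc_algebra mul2;
  cmp_rep1 : comm_assoc_rep mul1 mu1;
  cmp_rep2 : comm_assoc_rep mul2 mu2;
  cmp_mu1 : forall x1 x2 y2,
    mu1 x1 (mul2 x2 y2) = mul2 (mu1 x1 x2) y2 + mu1 (mu2 x2 x1) y2;
  cmp_mu2 : forall x2 x1 y1,
    mu2 x2 (mul1 x1 y1) = mul1 (mu2 x2 x1) y1 + mu2 (mu1 x1 x2) y1 }.

Record almost_Poisson_matched_pair A1 A2 (br1 mul1 : bilin A1)
    (br2 mul2 : bilin A2) (rho1 mu1 : 'Hom(A1, 'End(A2)))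
    (rho2 mu2 : 'Hom(A2, 'End(A1))) : Prop := {
  amp_algebra1 : almost_Poisson_algebra br1 mul1;
  amp_algebra2 : almost_Poisson_algebra br2 mul2;
  amp_comm_assoc : comm_assoc_matched_pair mul1 mul2 mu1 mu2;
  amp_rep1 : almost_Poisson_rep br1 mul1 rho1 mu1;
  amp_rep2 : almost_Poisson_rep br2 mul2 rho2 mu2;
  amp_rho2_mul : forall x2 x1 y1,
    rho2 x2 (mul1 x1 y1) =
      mul1 (rho2 x2 x1) y1 + mul1 x1 (rho2 x2 y1)
      - mu2 (rho1 x1 x2) y1 - mu2 (rho1 y1 x2) x1;
  amp_rho1_mul : forall x1 x2 y2,
    rho1 x1 (mul2 x2 y2) =
      mul2 (rho1 x1 x2) y2 + mul2 x2 (rho1 x1 y2)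
      - mu1 (rho2 x2 x1) y2 - mu1 (rho2 y2 x1) x2;
  amp_br1 : forall x1 y1 x2,
    br1 x1 (mu2 x2 y1) - rho2 (mu1 y1 x2) x1 =
      mu2 (rho1 x1 x2) y1 - mul1 (rho2 x2 x1) y1 + mu2 x2 (br1 x1 y1);
  amp_br2 : forall x2 y2 x1,
    br2 x2 (mu1 x1 y2) - rho1 (mu2 y2 x1) x2 =
      mu1 (rho2 x2 x1) y2 - mul2 (rho1 x1 x2) y2 + mu1 x1 (br2 x2 y2) }.

Definition almost_Poisson_subalgebra P (br mul : bilin P) (S : {vspace P}) :=
  {in S &, forall x y, br x y \in S} /\ {in S &, forall x y, mul x y \in S}.

Definition isotropic P (omega : {biscalar P}) (S : {vspace P}) : Prop :=
  {in S &, forall x y, omega x y = 0}.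

Record Manin_triple P (br mul : bilin P) (Pp Pm : {vspace P})
    (omega : {biscalar P}) : Prop := {
  mt_algebra : almost_Poisson_algebra br mul;
  mt_nondegenerate : forall x, (forall y, omega x y = 0) -> x = 0;
  mt_symmetric : forall x y, omega x y = omega y x;
  mt_invariant_mul : forall x y z, omega (mul x y) z = omega x (mul y z);
  mt_invariant_br : forall x y z, omega (br x y) z = omega x (br y z);
  mt_subalgebra_p : almost_Poisson_subalgebra br mul Pp;
  mt_subalgebra_m : almost_Poisson_subalgebra br mul Pm;
  mt_sum : (Pp + Pm = fullv)%VS;
  mt_direct : directv (Pp + Pm);
  mt_isotropic_p : isotropic omega Pp;
  mt_isotropic_m : isotropic omega Pm }.

(* The operation f^* : A^* (x) A^* -> A^* transpose to f, where A^* (x) A^*   *)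
(* is sent to (A (x) A)^* by dtens.                                           *)
Definition transpose A (f : 'Hom(A, A ⊗ A)) : bilin (dual A) :=
  linfun (fun xi : dual A => linfun (fun eta : dual A =>
    ((dtens xi eta \o f)%VF : dual A))).

Lemma transposeE A (f : 'Hom(A, A ⊗ A)) (xi eta : dual A) x :
  transpose f xi eta x = dtens xi eta (f x).
Proof.
have linr (z : dual A) : linear (fun eta : dual A =>
    ((dtens z eta \o f)%VF : dual A)).
  move=> a g h; rewrite comp_lfunZl -comp_lfunDl; congr (_ \o _)%VF.
  apply/tensorP=> u v; rewrite add_lfunE scale_lfunE !dtensE.
  by rewrite add_lfunE scale_lfunE mulrDr -scalerAr.
have linl : linear (fun z : dual A => linfun (fun eta : dual A =>
    ((dtens z eta \o f)%VF : dual A))).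
  move=> a g h; apply/lfunP=> z; rewrite add_lfunE scale_lfunE !linfunE //.
  rewrite comp_lfunZl -comp_lfunDl; congr (_ \o _)%VF.
  apply/tensorP=> u v; rewrite add_lfunE scale_lfunE !dtensE.
  by rewrite add_lfunE scale_lfunE mulrDl -scalerAl.
by rewrite /transpose linfunE // linfunE // comp_lfunE.
Qed.

Definition dual_double A : vectType K := (A * dual A)%type.

Definition inA A (x : A) : dual_double A := (x, 0).
Definition inAd A (xi : dual A) : dual_double A := (0, xi).

Lemma inA_linear A : linear (@inA A).
Proof. by move=> a x y; congr pair; rewrite /= scaler0 addr0. Qed.

Lemma inAd_linear A : linear (@inAd A).
Proof. by move=> a x y; congr pair; rewrite /= scaler0 addr0. Qed.

Definition omega_d A (p q : dual_double A) : K := q.2 p.1 + p.2 q.1.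

Lemma omega_d_is_bilinear A :
  bilinear_for (GRing.Scale.Law.clone _ _ *%R _)
    (GRing.Scale.Law.clone _ _ *%R _) (@omega_d A : _ -> _ -> K).
Proof.
split=> p a q r; rewrite /omega_d /= linearP add_lfunE scale_lfunE /=.
  by rewrite mulrDr addrACA.
by rewrite mulrDr addrACA.
Qed.

HB.instance Definition _ A :=
  bilinear_isBilinear.Build K (dual_double A) (dual_double A) K _ _ (@omega_d A)
    (@omega_d_is_bilinear A).

Definition standard_Manin_triple A (br mul : bilin A)
    (br' mul' : bilin (dual A)) : Prop :=
  exists BR MUL : bilin (dual_double A),
    [/\ forall x y : A, BR (inA x) (inA y) = inA (br x y),
        forall x y : A, MUL (inA x) (inA y) = inA (mul x y),
        forall xi eta : dual A, BR (inAd xi) (inAd eta) = inAd (br' xi eta),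
        forall xi eta : dual A, MUL (inAd xi) (inAd eta) = inAd (mul' xi eta) &
        Manin_triple BR MUL (limg (linfun (@inA A))) (limg (linfun (@inAd A)))
          (@omega_d A)].

End AlmostPoisson.

(* Main.v *)
Require Import Defs.
From mathcomp Require Import all_boot all_order all_algebra.
From mathcomp Require Import ring.

(** D-bialgebras and matched pairs are related by moving operators across the
    pairing.  An equality of tensors holds if and only if it holds after pairing
    with all xi ⊗ eta.  Since the operations of A^* are the transposes of Delta
    and delta, the three compatibility axioms of a D-bialgebra become three
    scalar identities between the operations of A and those of A^*, the record
    dual_compatible, while the coalgebra axioms become the axioms of the algebra
    A^* (transpose_coalgebra, D_bialgebra_dual_compatible).  The conditions of a
    matched pair for the coadjoint actions give the same three identities when
    they are paired with a functional or evaluated at a vector, because the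
    coadjoint actions are by definition adjoint to L and ad
    (matched_pair_dual_compatible).

    Matched pairs and Manin triples are related through the bicrossed operations
    on A1 ⊕ A2, which are almost Poisson exactly when the actions form a matched
    pair (bicross_almost_Poisson).  For the coadjoint actions these operations
    are invariant for omega_d (bicross_invariant).  Conversely, an invariant
    operation on A ⊕ A^* is determined by its restrictions to A and A^*, since
    two of the three arguments of omega_d(p q, r) always lie in the same half
    and invariance lets one multiply these two (invariant_op_unique).  Hence the
    operations of a standard Manin triple are the bicrossed ones, and its
    existence means that these are almost Poisson. *)

Set Implicit Arguments.
Unset Strict Implicit.
Unset Printing Implicit Defensive.

Import GRing.Theory.
Local Open Scope ring_scope.

(** * Linear functionals and tensor products *)

Definition lfun2 (K : fieldType) (U V W : vectType K) (f : U -> V -> W) :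
    'Hom(U, 'Hom(V, W)) :=
  linfun (fun u => linfun (f u)).

Lemma lfun2E (K : fieldType) (U V W : vectType K) (f : U -> V -> W) u v :
    (forall u, linear (f u)) -> (forall v, linear (f^~ v)) ->
  lfun2 f u v = f u v.
Proof.
move=> linr linl; rewrite /lfun2 linfunE ?linfunE // => a x y.
by apply/lfunP=> w; rewrite add_lfunE scale_lfunE !linfunE // linl.
Qed.

Lemma lfun2Dl (K : fieldType) (U V W : vectType K) (f : 'Hom(U, 'Hom(V, W)))
    u u' v :
  f (u + u') v = f u v + f u' v.
Proof. by rewrite linearD add_lfunE. Qed.

Lemma lfun2Nl (K : fieldType) (U V W : vectType K) (f : 'Hom(U, 'Hom(V, W)))
    u v :
  f (- u) v = - f u v.
Proof. by rewrite linearN opp_lfunE. Qed.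

Lemma dual_separates (K : fieldType) (V : vectType K) (u v : V) :
  (forall xi : dual V, xi u = xi v) -> u = v.
Proof.
move=> eq_uv; rewrite (coord_vbasis (memvf u)) [RHS](coord_vbasis (memvf v)).
apply: eq_bigr => i _; congr (_ *: _).
have lin_coord : linear (coord (vbasis {:V}) i : V -> K^o).
  by move=> a x y; rewrite linearP.
by have := eq_uv (linfun (coord (vbasis {:V}) i : V -> K^o)); rewrite !linfunE.
Qed.

Lemma dtens_map (K : fieldType) (U V U' V' : vectType K)
    (xi : dual U') (eta : dual V') (f : 'Hom(U, U')) (g : 'Hom(V, V')) t :
  dtens xi eta ((f \ox g) t) = dtens (xi \o f)%VF (eta \o g)%VF t.
Proof.
rewrite -comp_lfunE; congr (fun_of_lfun _ t); apply/tensorP=> u v.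
by rewrite comp_lfunE tmapE !dtensE !comp_lfunE.
Qed.

Lemma dtens_swap (K : fieldType) (U V : vectType K)
    (xi : dual V) (eta : dual U) t :
  dtens xi eta (tswap U V t) = dtens eta xi t.
Proof.
rewrite -comp_lfunE; congr (fun_of_lfun _ t); apply/tensorP=> u v.
by rewrite comp_lfunE tswapE !dtensE mulrC.
Qed.

Lemma tensor3P (K : fieldType) (U V W X : vectType K)
    (f g : 'Hom(U ⊗ (V ⊗ W), X)) :
  (forall u v w, f (tens u (tens v w)) = g (tens u (tens v w))) -> f = g.
Proof.
move=> eq_fg; apply/tensorP=> u s.
pose tens_u : 'Hom(V ⊗ W, U ⊗ (V ⊗ W)) := linfun (fun s => tens u s).
have tens_uE r : tens_u r = tens u r.
  by rewrite /tens_u linfunE //; apply: tensDr.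
rewrite -tens_uE -!comp_lfunE; congr (fun_of_lfun _ s); apply/tensorP=> v w.
by rewrite !comp_lfunE tens_uE.
Qed.

Lemma dtens_assoc (K : fieldType) (U V W : vectType K)
    (xi : dual U) (eta : dual V) (zeta : dual W) t :
  dtens (dtens xi eta) zeta (tassoc U V W t) = dtens xi (dtens eta zeta) t.
Proof.
rewrite -comp_lfunE; congr (fun_of_lfun _ t); apply/tensor3P=> u v w.
by rewrite comp_lfunE tassocE !dtensE mulrA.
Qed.

(** The entries of the coordinate matrix of a tensor are its pairings with the
    products of coordinate functionals. *)
Lemma dtens_separates (K : fieldType) (U V : vectType K) (s t : U ⊗ V) :
  (forall xi eta, dtens xi eta s = dtens xi eta t) -> s = t.
Proof.
move=> eq_st; apply/matrixP=> i j.
have lin_coord (W : vectType K) k : linear (coord (vbasis {:W}) k : W -> K^o).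
  by move=> a x y; rewrite linearP.
have lin_entry : linear (fun r : U ⊗ V => ((r : 'M_(_, _)) i j : K^o)).
  by move=> a r r'; rewrite !mxE.
pose entry : dual (U ⊗ V) :=
  linfun (fun r : U ⊗ V => ((r : 'M_(_, _)) i j : K^o)).
have entryE r : (r : 'M_(_, _)) i j = entry r by rewrite /entry linfunE.
rewrite !entryE.
suff -> : entry = dtens (linfun (coord (vbasis {:U}) i : U -> K^o))
                        (linfun (coord (vbasis {:V}) j : V -> K^o)).
  exact: eq_st.
by apply/tensorP=> u v; rewrite -entryE dtensE !linfunE // mxE.
Qed.

(** Contracting the second factor against zeta leaves an element of U, on which
    an arbitrary functional phi can be tested; when U is itself a tensor
    product, this is what reduces a general phi to pure ones. *)
Lemma dtens_slice (K : fieldType) (U V : vectType K)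
    (phi : dual U) (zeta : dual V) t :
  dtens phi zeta t = phi (tlift (fun (u : U) (v : V) => zeta v *: u) t).
Proof.
rewrite -comp_lfunE; congr (fun_of_lfun _ t); apply/tensorP=> u v.
rewrite comp_lfunE dtensE (@tliftE _ _ _ _ (fun u v => zeta v *: u)).
- by rewrite linearZ /= mulrC.
- by move=> w a x y; rewrite linearP scalerDl scalerA.
- by move=> w a x y; rewrite scalerDr !scalerA mulrC.
Qed.

Lemma dtens3_separates (K : fieldType) (U V W : vectType K)
    (s t : U ⊗ V ⊗ W) :
  (forall xi eta zeta,
     dtens (dtens xi eta) zeta s = dtens (dtens xi eta) zeta t) -> s = t.
Proof.
move=> eq_st; apply: dtens_separates => phi zeta; rewrite !dtens_slice.
congr (phi _); apply: dtens_separates => xi eta.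
by rewrite -!dtens_slice.
Qed.

(** * The three compatibility conditions, paired with functionals *)

(** Each coalgebra axiom, paired with functionals of A, is the corresponding
    algebra axiom of the dual, and pure functionals separate tensors. *)
Lemma transpose_coalgebra (K : fieldType) (A : vectType K)
    (Delta delta : 'Hom(A, A ⊗ A)) :
  almost_Poisson_algebra (transpose delta) (transpose Delta) ->
  almost_Poisson_coalgebra Delta delta.
Proof.
have pair_r (f : 'Hom(A, A ⊗ A)) (xi eta zeta : dual A) t :
    dtens (dtens xi eta) zeta (tassoc A A A ((\1%VF \ox f) t))
    = dtens xi (transpose f eta zeta) t.
  rewrite dtens_assoc dtens_map comp_lfun1r; congr (dtens _ _ _).
  by apply/lfunP=> x; rewrite comp_lfunE transposeE.
have pair_l (f : 'Hom(A, A ⊗ A)) (xi eta zeta : dual A) t :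
    dtens (dtens xi eta) zeta ((f \ox \1%VF) t)
    = dtens (transpose f xi eta) zeta t.
  rewrite dtens_map comp_lfun1r; congr (dtens _ _ _).
  by apply/lfunP=> x; rewrite comp_lfunE transposeE.
have pair_swap (xi eta zeta : dual A) t :
    dtens (dtens xi eta) zeta ((tswap A A \ox \1%VF) t)
    = dtens (dtens eta xi) zeta t.
  rewrite dtens_map comp_lfun1r; congr (dtens _ _ _).
  by apply/lfunP=> s; rewrite comp_lfunE dtens_swap.
move=> [[comm assoc] skew leibniz]; split; first split=> x.
- apply: dtens_separates => xi eta.
  by rewrite dtens_swap -!transposeE comm.
- apply: dtens3_separates => xi eta zeta.
  by rewrite pair_r pair_l -!transposeE assoc.
- move=> x; apply: dtens_separates => xi eta.
  by rewrite dtens_swap linearN /= -!transposeE skew opp_lfunE.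
- move=> x; apply: dtens3_separates => xi eta zeta.
  rewrite linear0 !linearB /= pair_swap !pair_r pair_l -!transposeE leibniz.
  by rewrite add_lfunE addrAC addrK subrr.
Qed.

(** The common form of the bialgebra and matched pair conditions.  With
    br' and mul' the transposes of delta and Delta, these are the three
    compatibility axioms of a D-bialgebra paired with xi ⊗ eta, the operators
    L(x) and ad(x) acting on a tensor factor having been moved to the functional
    that is paired with this factor. *)
Record dual_compatible (K : fieldType) (A : vectType K) (br mul : bilin A)
    (br' mul' : bilin (dual A)) : Prop := {
  dc_mul_mul : forall x y xi eta,
    mul' xi eta (mul x y) =
      mul' (xi \o mul x)%VF eta y + mul' xi (eta \o mul y)%VF x;
  dc_br_mul : forall x y xi eta,
    br' xi eta (mul x y) =
      br' xi (eta \o mul x)%VF y + br' xi (eta \o mul y)%VF x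
      - mul' (xi \o br y)%VF eta x - mul' (xi \o br x)%VF eta y;
  dc_mul_br : forall x y xi eta,
    mul' xi eta (br x y) =
      br' (xi \o mul y)%VF eta x - br' xi (eta \o mul y)%VF x
      + mul' xi (eta \o br x)%VF y + mul' (xi \o br x)%VF eta y }.

Lemma D_bialgebra_dual_compatible (K : fieldType) (A : vectType K)
    (br mul : bilin A) (Delta delta : 'Hom(A, A ⊗ A)) :
    almost_Poisson_algebra br mul ->
    almost_Poisson_algebra (transpose delta) (transpose Delta) ->
  almost_Poisson_D_bialgebra br mul Delta delta <->
  dual_compatible br mul (transpose delta) (transpose Delta).
Proof.
move=> hA hAd.
have pair_l (f : 'Hom(A, A ⊗ A)) (g : 'End(A)) xi eta x :
    dtens xi eta ((g \ox \1%VF) (f x)) = transpose f (xi \o g)%VF eta x.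
  by rewrite dtens_map comp_lfun1r transposeE.
have pair_r (f : 'Hom(A, A ⊗ A)) (g : 'End(A)) xi eta x :
    dtens xi eta ((\1%VF \ox g) (f x)) = transpose f xi (eta \o g)%VF x.
  by rewrite dtens_map comp_lfun1r transposeE.
split=> [[_ _ D1 D2 D3] | [S1 S2 S3]].
  split=> x y xi eta.
  - by rewrite {1}transposeE D1 linearD /= pair_l pair_r.
  - have /(congr1 (dtens xi eta)) := D2 x y.
    rewrite !(linearD, linearN, linear0) /= !pair_l !pair_r -transposeE => D.
    apply/eqP; rewrite -subr_eq0 -D; apply/eqP; ring.
  - have /(congr1 (dtens xi eta)) := D3 x y.
    rewrite !(linearD, linearN, linear0) /= !pair_l !pair_r -transposeE => D.
    apply/eqP; rewrite -subr_eq0 -D; apply/eqP; ring.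
split=> //; first exact: transpose_coalgebra.
- move=> x y; apply: dtens_separates => xi eta.
  by rewrite linearD /= pair_l pair_r -transposeE S1.
- move=> x y; apply: dtens_separates => xi eta.
  rewrite !(linearD, linearN, linear0) /= !pair_l !pair_r -transposeE S2; ring.
- move=> x y; apply: dtens_separates => xi eta.
  rewrite !(linearD, linearN, linear0) /= !pair_l !pair_r -transposeE S3; ring.
Qed.

Lemma dual_rep_comp (K : fieldType) (B V : vectType K)
    (theta : 'Hom(B, 'End(V))) b (xi : dual V) :
  dual_rep theta b xi = - (xi \o theta b)%VF.
Proof. by apply/lfunP=> v; rewrite dual_repE opp_lfunE comp_lfunE. Qed.

Lemma opp_dual_rep_comp (K : fieldType) (B V : vectType K)
    (theta : 'Hom(B, 'End(V))) b (xi : dual V) :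
  (- dual_rep theta) b xi = (xi \o theta b)%VF.
Proof. by rewrite !opp_lfunE dual_rep_comp opprK. Qed.

Lemma opp_codual_repE (K : fieldType) (B V : vectType K)
    (theta : 'Hom(B, 'End(dual V))) b (xi : dual V) v :
  xi ((- codual_rep theta) b v) = theta b xi v.
Proof. by rewrite !opp_lfunE linearN /= codual_repE opprK. Qed.

Lemma adjoint_rep (K : fieldType) (A : vectType K) (br mul : bilin A) :
  almost_Poisson_algebra br mul -> almost_Poisson_rep br mul br mul.
Proof.
move=> [[comm assoc] skew leibniz]; split=> x y v; first exact: assoc.
  rewrite skew leibniz (comm _ y) (skew v x) (skew v y) !linearN /=.
  by rewrite opprD !opprK.
by rewrite leibniz addrK.
Qed.

(** The condition on rho with its compositions reversed; the two terms
    mu([x,y]) and mu([y,x]) produced by commuting rho with mu cancel. *)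
Lemma rep_rho_mul_rev (K : fieldType) (A V : vectType K) (br mul : bilin A)
    (rho mu : 'Hom(A, 'End(V))) x y v :
    almost_Poisson_algebra br mul -> almost_Poisson_rep br mul rho mu ->
  rho (mul x y) v = rho x (mu y v) + rho y (mu x v).
Proof.
move=> [_ skew _] [_ rhoM mu_br].
have rho_mu a b : rho a (mu b v) = mu (br a b) v + mu b (rho a v).
  by rewrite mu_br subrK.
by rewrite !rho_mu (skew y x) lfun2Nl addrACA subrr add0r rhoM.
Qed.

(** Passing to transposes reverses compositions, so the dual maps satisfy the
    conditions on a representation with their compositions reversed; these hold
    by commutativity and rep_rho_mul_rev. *)
Lemma dual_rep_rep (K : fieldType) (A V : vectType K) (br mul : bilin A)
    (rho mu : 'Hom(A, 'End(V))) :
    almost_Poisson_algebra br mul -> almost_Poisson_rep br mul rho mu ->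
  almost_Poisson_rep br mul (dual_rep rho) (- dual_rep mu).
Proof.
move=> hA hV; have [[comm _] _ _] := hA; have [muM _ mu_br] := hV.
split=> x y xi; apply/lfunP=> v;
  rewrite !(opp_dual_rep_comp, dual_rep_comp, linearN) /=;
  rewrite !(add_lfunE, opp_lfunE, comp_lfunE).
- by rewrite comm muM.
- by rewrite (rep_rho_mul_rev _ _ _ hA hV) linearD /= opprD.
- by rewrite mu_br linearB /=; ring.
Qed.

Lemma codual_rep_rep (K : fieldType) (B V : vectType K) (br mul : bilin B)
    (rho mu : 'Hom(B, 'End(dual V))) :
    almost_Poisson_algebra br mul -> almost_Poisson_rep br mul rho mu ->
  almost_Poisson_rep br mul (codual_rep rho) (- codual_rep mu).
Proof.
move=> hB hV; have [[comm _] _ _] := hB; have [muM _ mu_br] := hV.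
split=> x y v; apply: dual_separates => xi;
  rewrite ?(linearD, linearN) /= !(codual_repE, opp_codual_repE).
- by rewrite comm muM.
- by rewrite (rep_rho_mul_rev _ _ _ hB hV) add_lfunE opprD.
- by rewrite mu_br add_lfunE opp_lfunE; ring.
Qed.

(** The representation conditions always hold, by dual_rep_rep and codual_rep_rep.
    Each of the six remaining matched pair conditions is an equality in A or in
    the dual of A; paired with a functional, respectively evaluated at a vector,
    it becomes one of the three identities of dual_compatible, each of which
    occurs twice: mu1 and mu2 give dc_mul_mul, rho2_mul and br2 give dc_br_mul,
    rho1_mul and br1 give dc_mul_br. *)
Lemma matched_pair_dual_compatible (K : fieldType) (A : vectType K)
    (br mul : bilin A) (br' mul' : bilin (dual A)) :
    almost_Poisson_algebra br mul -> almost_Poisson_algebra br' mul' ->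
  almost_Poisson_matched_pair br mul br' mul' (dual_rep br) (- dual_rep mul)
    (codual_rep br') (- codual_rep mul') <->
  dual_compatible br mul br' mul'.
Proof.
move=> hA hA'; have [[comm assoc] skew _] := hA.
have [[comm' assoc'] skew' _] := hA'.
have rep_A := dual_rep_rep hA (adjoint_rep hA).
have rep_Ad := codual_rep_rep hA' (adjoint_rep hA').
(* mul_l to opp_br_l: the action of A^* on A, paired with a functional after a
   multiplication or a bracket, is an operation of A^* evaluated at a vector. *)
have mul_l (t : bilin (dual A)) (xi eta : dual A) x y :
    eta (mul (codual_rep t xi x) y) = - t xi (eta \o mul y)%VF x.
  by rewrite comm -[LHS]comp_lfunE codual_repE.
have mul_r (t : bilin (dual A)) (xi eta : dual A) x y :
    eta (mul y (codual_rep t xi x)) = - t xi (eta \o mul y)%VF x.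
  by rewrite comm mul_l.
have opp_mul_l (t : bilin (dual A)) (xi eta : dual A) x y :
    eta (mul ((- codual_rep t) xi x) y) = t xi (eta \o mul y)%VF x.
  by rewrite comm -[LHS]comp_lfunE opp_codual_repE.
have opp_br_r (t : bilin (dual A)) (xi eta : dual A) x y :
    eta (br y ((- codual_rep t) xi x)) = t xi (eta \o br y)%VF x.
  by rewrite -[LHS]comp_lfunE opp_codual_repE.
have opp_br_l (t : bilin (dual A)) (xi eta : dual A) x y :
    eta (br ((- codual_rep t) xi x) y) = - t xi (eta \o br y)%VF x.
  by rewrite skew linearN /= opp_br_r.
have evE := (mul_l, mul_r, opp_mul_l, opp_br_r, opp_br_l,
             opp_dual_rep_comp, dual_rep_comp, opp_codual_repE, codual_repE).
have oppE (t : bilin (dual A)) xi eta x :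
    (t (- xi) eta x = - t xi eta x) * (t eta (- xi) x = - t eta xi x).
  by rewrite !linearN !opp_lfunE.
split=> [[_ _ [_ _ _ _ _ mu2M] _ _ rho2M _ br1M _] | [S1 S2 S3]].
  split=> x y xi eta.
  - have /(congr1 eta) := mu2M xi x y.
    by rewrite linearD /= !evE addrC.
  - have /(congr1 eta) := rho2M xi x y.
    rewrite !(linearD, linearN) /= !evE !oppE => E.
    rewrite -[LHS]opprK {}E; ring.
  - have /(congr1 eta) := br1M x y xi.
    rewrite !(linearD, linearN) /= !evE !oppE => /esym.
    move/(canRL (addKr _)) => ->; ring.
split=> //.
- split=> //; [by case: rep_A | by case: rep_Ad | |].
    move=> x xi eta; apply/lfunP=> y.
    by rewrite !(add_lfunE, opp_dual_rep_comp, comp_lfunE) S1 !evE.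
  move=> xi x y; apply: dual_separates => eta.
  by rewrite linearD /= !evE S1 addrC.
- move=> xi x y; apply: dual_separates => eta.
  rewrite !(linearD, linearN) /= !evE !oppE S2; ring.
- move=> x xi eta; apply/lfunP => y.
  rewrite !(dual_rep_comp, opp_dual_rep_comp).
  rewrite !(add_lfunE, opp_lfunE, comp_lfunE) !oppE.
  by rewrite !evE [br' eta _]skew' opp_lfunE S3; ring.
- move=> x y xi; apply: dual_separates => eta.
  rewrite !(linearD, linearN) /= !evE !oppE S3; ring.
- move=> xi eta x; apply/lfunP => y.
  rewrite !(dual_rep_comp, opp_dual_rep_comp) opprK !(add_lfunE, comp_lfunE).
  rewrite !evE !opp_lfunE !oppE.
  by rewrite [mul' eta _]comm' S2; ring.
Qed.

(** * Bicrossed products *)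

(** The operation on A1 ⊕ A2 that restricts to op1 and op2 and whose mixed
    values are x1 x2 = r2(x2) x1 + l1(x1) x2 and x2 x1 = l2(x2) x1 + r1(x1) x2.
    A commutative product has r = l, a skew-symmetric bracket has r = - l. *)
Definition bicross (K : fieldType) (A1 A2 : vectType K)
    (op1 : bilin A1) (op2 : bilin A2) (l1 r1 : 'Hom(A1, 'End(A2)))
    (l2 r2 : 'Hom(A2, 'End(A1))) : bilin (A1 * A2)%type :=
  lfun2 (fun p q : A1 * A2 =>
    (op1 p.1 q.1 + l2 p.2 q.1 + r2 q.2 p.1,
     op2 p.2 q.2 + l1 p.1 q.2 + r1 q.1 p.2)).

Section Bicross.
Variables (K : fieldType) (A1 A2 : vectType K) (op1 : bilin A1) (op2 : bilin A2)
  (l1 r1 : 'Hom(A1, 'End(A2))) (l2 r2 : 'Hom(A2, 'End(A1))).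
Local Notation op := (bicross op1 op2 l1 r1 l2 r2).

Lemma bicrossE p q : op p q =
  (op1 p.1 q.1 + l2 p.2 q.1 + r2 q.2 p.1,
   op2 p.2 q.2 + l1 p.1 q.2 + r1 q.1 p.2).
Proof.
have lin3 (V : lmodType K) (a : K) (u1 u2 u3 v1 v2 v3 : V) :
    a *: u1 + v1 + (a *: u2 + v2) + (a *: u3 + v3)
    = a *: (u1 + u2 + u3) + (v1 + v2 + v3).
  by rewrite (addrACA (a *: u1)) (addrACA (a *: u1 + a *: u2)) !scalerDr.
rewrite /bicross lfun2E //= => {p q}p a q s /=; congr pair;
  by rewrite !linearP /= !(add_lfunE, scale_lfunE) lin3.
Qed.

Lemma bicross_lE x p : op (x, 0) p = (op1 x p.1 + r2 p.2 x, l1 x p.2).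
Proof. by rewrite bicrossE /= !linear0 !zero_lfunE !(addr0, add0r). Qed.

Lemma bicross_rE x p : op (0, x) p = (l2 x p.1, op2 x p.2 + r1 p.1 x).
Proof. by rewrite bicrossE /= !linear0 !zero_lfunE !(addr0, add0r). Qed.

End Bicross.

Lemma pair_split (U V : nmodType) (p : U * V) : p = (p.1, 0) + (0, p.2).
Proof. by case: p => x y; congr pair; rewrite /= (addr0, add0r). Qed.

Lemma pair_additive_ind (U V : nmodType) (P : U * V -> Prop) :
    (forall p q, P p -> P q -> P (p + q)) ->
    (forall x, P (x, 0)) -> (forall y, P (0, y)) ->
  forall p, P p.
Proof. by move=> PD Pl Pr p; rewrite (pair_split p); apply: PD. Qed.

(** Associativity is additive in each argument, so its arguments may be taken in
    A1 or A2.  Two of the three then lie in the same summand, and commutativity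
    moves these two to the front. *)
Lemma pair_comm_assoc (K : fieldType) (A1 A2 : vectType K)
    (mul : bilin (A1 * A2)%type) :
    (forall p q, mul p q = mul q p) ->
    (forall x y p, mul (mul (x, 0) (y, 0)) p = mul (x, 0) (mul (y, 0) p)) ->
    (forall x y p, mul (mul (0, x) (0, y)) p = mul (0, x) (mul (0, y) p)) ->
  comm_assoc_algebra mul.
Proof.
move=> comm assoc_l assoc_r; split=> //.
elim/pair_additive_ind=> [p q IHp IHq y z | x | x].
- by rewrite !lfun2Dl IHp IHq.
- elim/pair_additive_ind=> [p q IHp IHq z | y z | y].
  + by rewrite !(lfun2Dl, linearD) /= IHp IHq.
  + exact: assoc_l.
  + elim/pair_additive_ind=> [p q IHp IHq | z | z].
    * by rewrite !linearD /= IHp IHq.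
    * by rewrite comm -assoc_l (comm (0, y)) -assoc_l [mul (z, 0) _]comm.
    * by rewrite [RHS]comm (comm (x, 0)) [LHS]comm -assoc_r (comm (0, z)).
- elim/pair_additive_ind=> [p q IHp IHq z | y | y z].
  + by rewrite !(lfun2Dl, linearD) /= IHp IHq.
  + elim/pair_additive_ind=> [p q IHp IHq | z | z].
    * by rewrite !linearD /= IHp IHq.
    * by rewrite [RHS]comm (comm (0, x)) [LHS]comm -assoc_l (comm (z, 0)).
    * by rewrite comm -assoc_r (comm (y, 0)) -assoc_r [mul (0, z) _]comm.
  + exact: assoc_r.
Qed.

(** Same reduction as in pair_comm_assoc, but here commutativity only exchanges
    the last two arguments, which leaves two more mixed cases. *)
Lemma pair_leibniz (K : fieldType) (A1 A2 : vectType K)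
    (br mul : bilin (A1 * A2)%type) :
    (forall p q, mul p q = mul q p) ->
    let leib (p q r : A1 * A2) :=
      br p (mul q r) = mul (br p q) r + mul q (br p r) in
    (forall (x y : A1) p, leib (x, 0) (y, 0) p) ->
    (forall (x y : A2) p, leib (0, x) (0, y) p) ->
    (forall x y z, leib (x, 0) (0, y) (0, z)) ->
    (forall x y z, leib (0, x) (y, 0) (z, 0)) ->
  forall p q r, leib p q r.
Proof.
move=> comm leib leib_ll leib_rr leib_lrr leib_rll.
have leibC p q r : leib p q r -> leib p r q.
  by rewrite /leib comm (comm _ r) (comm q) addrC.
have leibDr p q r s : leib p q r -> leib p q s -> leib p q (r + s).
  by rewrite /leib !linearD /= addrACA => -> ->.
elim/pair_additive_ind=> [p q IHp IHq r s | x | x].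
- by rewrite /leib !(lfun2Dl, linearD) /= IHp IHq addrACA.
- elim/pair_additive_ind=> [p q IHp IHq r | y | y]; last 1 first.
  + elim/pair_additive_ind=> [p q IHp IHq | z | z]; first exact: leibDr.
      exact/leibC/leib_ll.
    exact: leib_lrr.
  + by apply/leibC/leibDr; apply: leibC.
  + exact: leib_ll.
- elim/pair_additive_ind=> [p q IHp IHq r | y | y]; last 1 first.
  + exact: leib_rr.
  + by apply/leibC/leibDr; apply: leibC.
  + elim/pair_additive_ind=> [p q IHp IHq | z | z]; first exact: leibDr.
      exact: leib_rll.
    exact/leibC/leib_rr.
Qed.

(** Splitting the axioms of the bicrossed product by the summands of their
    arguments and of their values gives the axioms of A1 and A2, the
    representation conditions and the matched pair conditions.  By the two
    reductions above, associativity need only be split for arguments of types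
    (1, 1, any) and (2, 2, any), and the Leibniz rule also for (1, 2, 2) and
    (2, 1, 1). *)
Lemma bicross_almost_Poisson (K : fieldType) (A1 A2 : vectType K)
    (br1 mul1 : bilin A1) (br2 mul2 : bilin A2)
    (rho1 mu1 : 'Hom(A1, 'End(A2))) (rho2 mu2 : 'Hom(A2, 'End(A1))) :
  almost_Poisson_matched_pair br1 mul1 br2 mul2 rho1 mu1 rho2 mu2 <->
  almost_Poisson_algebra (bicross br1 br2 rho1 (- rho1) rho2 (- rho2))
    (bicross mul1 mul2 mu1 mu1 mu2 mu2).
Proof.
have mulE := bicrossE mul1 mul2 mu1 mu1 mu2 mu2.
have mul_lE := bicross_lE mul1 mul2 mu1 mu1 mu2 mu2.
have mul_rE := bicross_rE mul1 mul2 mu1 mu1 mu2 mu2.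
have br_lE := bicross_lE br1 br2 rho1 (- rho1) rho2 (- rho2).
have br_rE := bicross_rE br1 br2 rho1 (- rho1) rho2 (- rho2).
pose mul := bicross mul1 mul2 mu1 mu1 mu2 mu2.
pose br := bicross br1 br2 rho1 (- rho1) rho2 (- rho2).
have assoc_lE x y u v :
    mul (mul (x, 0) (y, 0)) (u, v) = mul (x, 0) (mul (y, 0) (u, v)) <->
    mul1 (mul1 x y) u + mu2 v (mul1 x y) =
      mul1 x (mul1 y u) + mul1 x (mu2 v y) + mu2 (mu1 y v) x /\
    mu1 (mul1 x y) v = mu1 x (mu1 y v).
  rewrite /mul !mul_lE /= !linear0 zero_lfunE addr0 mul_lE linearD /=.
  by split=> [[]|[-> ->]].
have assoc_rE x y u v :
    mul (mul (0, x) (0, y)) (u, v) = mul (0, x) (mul (0, y) (u, v)) <->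
    mu2 (mul2 x y) u = mu2 x (mu2 y u) /\
    mul2 (mul2 x y) v + mu1 u (mul2 x y) =
      mul2 x (mul2 y v) + mul2 x (mu1 u y) + mu1 (mu2 y u) x.
  rewrite /mul !mul_rE /= !linear0 zero_lfunE addr0 mul_rE linearD /=.
  by split=> [[]|[-> ->]].
pose leib p q r := br p (mul q r) = mul (br p q) r + mul q (br p r).
have leib_llE x y u v : leib (x, 0) (y, 0) (u, v) <->
    br1 x (mul1 y u) + br1 x (mu2 v y) - rho2 (mu1 y v) x =
      mul1 (br1 x y) u + mu2 v (br1 x y)
      + (mul1 y (br1 x u) - mul1 y (rho2 v x) + mu2 (rho1 x v) y) /\
    rho1 x (mu1 y v) = mu1 (br1 x y) v + mu1 y (rho1 x v).
  rewrite /leib /mul /br !mul_lE !br_lE /= !linear0 zero_lfunE addr0 mul_lE.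
  rewrite !(linearD, opp_lfunE, linearN) /=.
  by split=> [[]|[-> ->]].
have leib_rrE x y u v : leib (0, x) (0, y) (u, v) <->
    rho2 x (mu2 y u) = mu2 (br2 x y) u + mu2 y (rho2 x u) /\
    br2 x (mul2 y v) + br2 x (mu1 u y) - rho1 (mu2 y u) x =
      mul2 (br2 x y) v + mu1 u (br2 x y)
      + (mul2 y (br2 x v) - mul2 y (rho1 u x) + mu1 (rho2 x u) y).
  rewrite /leib /mul /br !mul_rE !br_rE /= !linear0 zero_lfunE addr0 mul_rE.
  rewrite !(linearD, opp_lfunE, linearN) /=.
  by split=> [[]|[-> ->]].
have leib_lrrE x y z : leib (x, 0) (0, y) (0, z) <->
    rho2 (mul2 y z) x = mu2 z (rho2 y x) + mu2 y (rho2 z x) /\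
    rho1 x (mul2 y z) = mul2 (rho1 x y) z - mu1 (rho2 y x) z
      + (mul2 y (rho1 x z) - mu1 (rho2 z x) y).
  rewrite /leib /mul /br !mul_rE !br_lE !mulE /=.
  rewrite !linear0 ?zero_lfunE ?add0r ?addr0.
  rewrite !opp_lfunE !lfun2Nl !linearN.
  split=> [[e ->] | [-> ->]]; last by rewrite opprD.
  by split=> //; apply: oppr_inj; rewrite e opprD.
have leib_rllE x y z : leib (0, x) (y, 0) (z, 0) <->
    rho2 x (mul1 y z) = mul1 (rho2 x y) z - mu2 (rho1 y x) z
      + (mul1 y (rho2 x z) - mu2 (rho1 z x) y) /\
    rho1 (mul1 y z) x = mu1 z (rho1 y x) + mu1 y (rho1 z x).
  rewrite /leib /mul /br !mul_lE !br_rE !mulE /=.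
  rewrite !linear0 ?zero_lfunE ?add0r ?addr0.
  rewrite !opp_lfunE !lfun2Nl !linearN.
  split=> [[-> e] | [-> ->]]; last by rewrite opprD.
  by split=> //; apply: oppr_inj; rewrite e opprD.
split.
  case=> [[[comm1 assoc1] skew1 leib1] [[comm2 assoc2] skew2 leib2]].
  case=> _ _ _ _ mu1M mu2M [mu1_rep rho1_rep mu1_br] [mu2_rep rho2_rep mu2_br].
  move=> rho2M rho1M br1M br2M.
  have comm p q : mul p q = mul q p.
    by rewrite !mulE comm1 comm2 -!addrA [mu2 _ _ + _]addrC [mu1 _ _ + _]addrC.
  split.
  - apply: pair_comm_assoc => // [x y [u v] | x y [u v]].
    + apply/assoc_lE; split; last exact: mu1_rep.
      rewrite (comm1 x y) mu2M -(comm1 x (mu2 v y)) addrA.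
      by rewrite (comm1 y x) assoc1.
    + apply/assoc_rE; split; first exact: mu2_rep.
      rewrite (comm2 x y) mu1M -(comm2 x (mu1 u y)) addrA.
      by rewrite (comm2 y x) assoc2.
  - move=> [x1 x2] [y1 y2]; rewrite !bicrossE /=; congr pair => /=.
      by rewrite (skew1 x1) !opp_lfunE !opprD opprK addrAC.
    by rewrite (skew2 x2) !opp_lfunE !opprD opprK addrAC.
  - apply: (pair_leibniz comm) => [x y [u v] | x y [u v] | x y z | x y z].
    + apply/leib_llE; split; last by rewrite mu1_br subrK.
      rewrite leib1 -addrA br1M (comm1 y (rho2 _ _)).
      rewrite -[_ - _ + mu2 _ y]addrA [RHS]addrACA [- _ + _]addrC.
      by rewrite [_ + (mu2 _ _ - _)]addrC.
    + apply/leib_rrE; split; first by rewrite mu2_br subrK.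
      rewrite leib2 -addrA br2M (comm2 y (rho1 _ _)).
      rewrite -[_ - _ + mu1 _ y]addrA [RHS]addrACA [- _ + _]addrC.
      by rewrite [_ + (mu1 _ _ - _)]addrC.
    + apply/leib_lrrE; split=> //.
      by rewrite rho1M addrACA addrA.
    + apply/leib_rllE; split=> //.
      by rewrite rho2M addrACA addrA.
move=> [[comm assoc] skew leibniz].
have skew1 x y : br1 x y = - br1 y x.
  have /(congr1 fst) := skew (x, 0) (y, 0).
  by rewrite !br_lE /= !linear0 !zero_lfunE !addr0.
have skew2 x y : br2 x y = - br2 y x.
  have /(congr1 snd) := skew (0, x) (0, y).
  by rewrite !br_rE /= !linear0 !zero_lfunE !addr0.
have comm1 x y : mul1 x y = mul1 y x.
  have /(congr1 fst) := comm (x, 0) (y, 0).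
  by rewrite !mul_lE /= !linear0 !zero_lfunE !addr0.
have comm2 x y : mul2 x y = mul2 y x.
  have /(congr1 snd) := comm (0, x) (0, y).
  by rewrite !mul_rE /= !linear0 !zero_lfunE !addr0.
have comm_assoc1 : comm_assoc_algebra mul1.
  split=> // x y z; have /assoc_lE[+ _] := assoc (x, 0) (y, 0) (z, 0).
  by rewrite !(linear0, zero_lfunE, addr0).
have comm_assoc2 : comm_assoc_algebra mul2.
  split=> // x y z; have /assoc_rE[_] := assoc (0, x) (0, y) (0, z).
  by rewrite !(linear0, zero_lfunE, addr0).
have mu1_rep : comm_assoc_rep mul1 mu1.
  by move=> x y v; have /assoc_lE[_] := assoc (x, 0) (y, 0) (0, v).
have mu2_rep : comm_assoc_rep mul2 mu2.
  by move=> x y u; have /assoc_rE[+ _] := assoc (0, x) (0, y) (u, 0).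
split=> //.
- split=> // x y z; have /leib_llE[+ _] := leibniz (x, 0) (y, 0) (z, 0).
  by rewrite !(linear0, zero_lfunE, addr0, oppr0).
- split=> // x y z; have /leib_rrE[_] := leibniz (0, x) (0, y) (0, z).
  by rewrite !(linear0, zero_lfunE, addr0, oppr0).
- split=> // [x u v | v x y].
    have /assoc_rE[_] := assoc (0, v) (0, u) (x, 0).
    by rewrite !(linear0, add0r) (comm2 u) (comm2 _ v).
  have /assoc_lE[+ _] := assoc (y, 0) (x, 0) (0, v).
  by rewrite !(linear0, add0r) (comm1 x) (comm1 _ y).
- split=> // x y v.
    by have /leib_rllE[_ ->] := leibniz (0, v) (x, 0) (y, 0).
  by have /leib_llE[_ ->] := leibniz (x, 0) (y, 0) (0, v); rewrite addrK.
- split=> // x y v.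
    by have /leib_lrrE[-> _] := leibniz (v, 0) (0, x) (0, y).
  by have /leib_rrE[-> _] := leibniz (0, x) (0, y) (v, 0); rewrite addrK.
- move=> v x y; have /leib_rllE[-> _] := leibniz (0, v) (x, 0) (y, 0).
  by rewrite addrACA addrA.
- move=> x v w; have /leib_lrrE[_ ->] := leibniz (x, 0) (0, v) (0, w).
  by rewrite addrACA addrA.
- move=> x y v; have /leib_llE[+ _] := leibniz (x, 0) (y, 0) (0, v).
  rewrite !(linear0, zero_lfunE, addr0, add0r) => ->.
  by rewrite addrC [- _ + _]addrC (comm1 y).
- move=> x y v; have /leib_rrE[_] := leibniz (0, x) (0, y) (v, 0).
  rewrite !(linear0, zero_lfunE, addr0, add0r) => ->.
  by rewrite addrC [- _ + _]addrC (comm2 y).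
Qed.

(** * Invariance of the standard form *)

Lemma omega_dE (K : fieldType) (A : vectType K) (p q : dual_double A) :
  omega_d p q = q.2 p.1 + p.2 q.1.
Proof. by []. Qed.

Lemma omega_d_nondegenerate (K : fieldType) (A : vectType K)
    (p : dual_double A) :
  (forall q, omega_d p q = 0) -> p = 0.
Proof.
case: p => x xi p0; congr pair.
  apply: dual_separates => eta; have := p0 (inAd eta).
  by rewrite omega_dE /= !linear0 addr0.
apply/lfunP=> y; have := p0 (inA y).
by rewrite omega_dE /= !zero_lfunE add0r.
Qed.

Lemma mem_limg_inA (K : fieldType) (A : vectType K) (p : dual_double A) :
  (p \in limg (linfun (@inA K A))) = (p.2 == 0).
Proof.
apply/idP/eqP=> [/memv_imgP[x _ ->] | p2].
  by rewrite linfunE //; apply: inA_linear.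
rewrite (_ : p = linfun (@inA K A) p.1); first by rewrite memv_img ?memvf.
by rewrite linfunE; [case: p p2 => x xi /= -> | apply: inA_linear].
Qed.

Lemma mem_limg_inAd (K : fieldType) (A : vectType K) (p : dual_double A) :
  (p \in limg (linfun (@inAd K A))) = (p.1 == 0).
Proof.
apply/idP/eqP=> [/memv_imgP[x _ ->] | p1].
  by rewrite linfunE //; apply: inAd_linear.
rewrite (_ : p = linfun (@inAd K A) p.2); first by rewrite memv_img ?memvf.
by rewrite linfunE; [case: p p1 => x xi /= -> | apply: inAd_linear].
Qed.

Lemma omega_dC (K : fieldType) (A : vectType K) (p q : dual_double A) :
  omega_d p q = omega_d q p.
Proof. by rewrite !omega_dE addrC. Qed.

Lemma omega_dDr (K : fieldType) (A : vectType K) (p q r : dual_double A) :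
  omega_d p (q + r) = omega_d p q + omega_d p r.
Proof. by rewrite !omega_dE /= add_lfunE linearD addrACA. Qed.

Lemma omega_dDl (K : fieldType) (A : vectType K) (p q r : dual_double A) :
  omega_d (p + q) r = omega_d p r + omega_d q r.
Proof. by rewrite !(omega_dC _ r) omega_dDr. Qed.

Lemma omega_d_separates (K : fieldType) (A : vectType K) (p q : dual_double A) :
  (forall r, omega_d p r = omega_d q r) -> p = q.
Proof.
move=> eq_pq; apply/subr0_eq/omega_d_nondegenerate => r.
by apply: (addIr (omega_d q r)); rewrite -omega_dDl subrK add0r.
Qed.

(** Invariance leaves no freedom for the mixed products.  In omega(p q, r) with
    p, q, r in A or the dual of A, two arguments lie in the same half, and
    omega(p q, r) = omega(p, q r) = omega(q, r p) by invariance and symmetry of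
    omega, so the value only involves a product taken inside one half. *)
Lemma invariant_op_unique (K : fieldType) (A : vectType K)
    (OP OP' : bilin (dual_double A)) :
    (forall p q r, omega_d (OP p q) r = omega_d p (OP q r)) ->
    (forall p q r, omega_d (OP' p q) r = omega_d p (OP' q r)) ->
    (forall x y, OP (inA x) (inA y) = OP' (inA x) (inA y)) ->
    (forall xi eta, OP (inAd xi) (inAd eta) = OP' (inAd xi) (inAd eta)) ->
  OP = OP'.
Proof.
move=> inv inv' eqA eqAd; apply/lfunP=> p; apply/lfunP=> q.
apply: omega_d_separates => r; move: p q r.
elim/pair_additive_ind=> [p q IHp IHq r s | x | xi].
- by rewrite !lfun2Dl !omega_dDl IHp IHq.
- elim/pair_additive_ind=> [p q IHp IHq r | y r | eta].
  + by rewrite !linearD /= !omega_dDl IHp IHq.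
  + by rewrite eqA.
  + elim/pair_additive_ind=> [p q IHp IHq | z | zeta].
    * by rewrite !omega_dDr IHp IHq.
    * by rewrite omega_dC [RHS]omega_dC -inv -inv' eqA.
    * by rewrite inv inv' eqAd.
- elim/pair_additive_ind=> [p q IHp IHq r | y | eta r].
  + by rewrite !linearD /= !omega_dDl IHp IHq.
  + elim/pair_additive_ind=> [p q IHp IHq | z | zeta].
    * by rewrite !omega_dDr IHp IHq.
    * by rewrite inv inv' eqA.
    * by rewrite omega_dC [RHS]omega_dC -inv -inv' eqAd.
  + by rewrite eqAd.
Qed.

Lemma bicross_inA (K : fieldType) (A : vectType K) (op : bilin A)
    (op' : bilin (dual A)) l1 r1 l2 r2 x y :
  bicross op op' l1 r1 l2 r2 (inA x) (inA y) = inA (op x y).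
Proof. by rewrite bicross_lE /= !linear0 zero_lfunE addr0. Qed.

Lemma bicross_inAd (K : fieldType) (A : vectType K) (op : bilin A)
    (op' : bilin (dual A)) l1 r1 l2 r2 xi eta :
  bicross op op' l1 r1 l2 r2 (inAd xi) (inAd eta) = inAd (op' xi eta).
Proof. by rewrite bicross_rE /= !linear0 zero_lfunE addr0. Qed.

(** The hypotheses determine l1 and l2 as the left mixed actions that invariance
    imposes; they are l = r for a commutative op and l = - r for a skew-symmetric
    one, so that the lemma applies both to the product and to the bracket. *)
Lemma bicross_invariant (K : fieldType) (A : vectType K) (op : bilin A)
    (op' : bilin (dual A)) (l1 : 'Hom(A, 'End(dual A)))
    (l2 : 'Hom(dual A, 'End(A))) :
    (forall x (xi : dual A) y, l1 x xi y = xi (op y x)) ->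
    (forall xi x (eta : dual A), eta (l2 xi x) = op' eta xi x) ->
  let OP := bicross op op' l1 (- dual_rep op) l2 (- codual_rep op') in
  forall p q r, omega_d (OP p q) r = omega_d p (OP q r).
Proof.
move=> l1E l2E OP p q r; rewrite /OP !bicrossE !omega_dE /=.
rewrite !opp_dual_rep_comp !linearD !add_lfunE /= !opp_codual_repE !comp_lfunE.
by rewrite !l1E !l2E; ring.
Qed.

(** By invariant_op_unique, the operations of a standard Manin triple can only be
    the bicrossed ones, which are invariant; the other axioms, apart from being
    an almost Poisson algebra, hold for these unconditionally. *)
Lemma bicross_standard_Manin_triple (K : fieldType) (A : vectType K)
    (br mul : bilin A) (br' mul' : bilin (dual A)) :
    almost_Poisson_algebra br mul -> almost_Poisson_algebra br' mul' ->
  almost_Poisson_algebra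
    (bicross br br' (dual_rep br) (- dual_rep br)
       (codual_rep br') (- codual_rep br'))
    (bicross mul mul' (- dual_rep mul) (- dual_rep mul)
       (- codual_rep mul') (- codual_rep mul')) <->
  standard_Manin_triple br mul br' mul'.
Proof.
move=> [[comm _] skew _] [[comm' _] skew' _].
set BR := bicross br _ _ _ _ _; set MUL := bicross mul _ _ _ _ _.
have BR_inv p q r : omega_d (BR p q) r = omega_d p (BR q r).
  apply: bicross_invariant => [x xi y | xi x eta].
    by rewrite dual_repE skew linearN opprK.
  by rewrite codual_repE skew' opp_lfunE opprK.
have MUL_inv p q r : omega_d (MUL p q) r = omega_d p (MUL q r).
  apply: bicross_invariant => [x xi y | xi x eta].
    by rewrite opp_dual_rep_comp comp_lfunE comm.
  by rewrite opp_codual_repE comm'.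
split=> [hP | [BR1 [MUL1 [BR_A MUL_A BR_Ad MUL_Ad triple]]]].
  exists BR, MUL; split=> *; rewrite ?bicross_inA ?bicross_inAd //.
  split=> //.
  - exact: omega_d_nondegenerate.
  - exact: omega_dC.
  - split=> p q; rewrite !mem_limg_inA => /eqP p2 /eqP q2;
      by rewrite bicrossE p2 q2 /= !linear0 !addr0.
  - split=> p q; rewrite !mem_limg_inAd => /eqP p1 /eqP q1;
      by rewrite bicrossE p1 q1 /= !linear0 !addr0.
  - apply/eqP; rewrite eqEsubv subvf /=; apply/subvP=> p _.
    by rewrite (pair_split p) memv_add ?mem_limg_inA ?mem_limg_inAd.
  - apply/directv_addP/eqP; rewrite -subv0; apply/subvP=> -[x xi].
    rewrite memv_cap mem_limg_inA mem_limg_inAd memv0 /=.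
    by move=> /andP[/eqP-> /eqP->].
  - move=> p q; rewrite !mem_limg_inA => /eqP p2 /eqP q2.
    by rewrite [LHS]omega_dE p2 q2 !zero_lfunE addr0.
  - move=> p q; rewrite !mem_limg_inAd => /eqP p1 /eqP q1.
    by rewrite [LHS]omega_dE p1 q1 !linear0 addr0.
have [hP _ _ invM invB _ _ _ _ _ _] := triple.
have -> : BR = BR1.
  by apply: invariant_op_unique => // *; rewrite ?bicross_inA ?bicross_inAd.
have -> // : MUL = MUL1.
by apply: invariant_op_unique => // *; rewrite ?bicross_inA ?bicross_inAd.
Qed.

(** * The equivalence *)

Theorem theorem3p10 (K : fieldType) (char0 : [pchar K] =i pred0)
    (A : vectType K) (br mul : bilin A) (Delta delta : 'Hom(A, A ⊗ A))
    (hA : almost_Poisson_algebra br mul)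
    (hAd : almost_Poisson_algebra (transpose delta) (transpose Delta)) :
  let bialgebra := almost_Poisson_D_bialgebra br mul Delta delta in
  let matched_pair :=
    almost_Poisson_matched_pair br mul (transpose delta) (transpose Delta)
      (dual_rep br) (- dual_rep mul)
      (codual_rep (transpose delta)) (- codual_rep (transpose Delta)) in
  let Manin :=
    standard_Manin_triple br mul (transpose delta) (transpose Delta) in
  (bialgebra <-> matched_pair) /\ (matched_pair <-> Manin).
Proof.
have to_dual := D_bialgebra_dual_compatible hA hAd.
have of_pair := matched_pair_dual_compatible hA hAd.
have to_bicross := bicross_almost_Poisson br mul (transpose delta)
  (transpose Delta) (dual_rep br) (- dual_rep mul)
  (codual_rep (transpose delta)) (- codual_rep (transpose Delta)).
have to_Manin := bicross_standard_Manin_triple hA hAd.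
move=> bialgebra matched_pair Manin; split.
  by split=> [/to_dual/of_pair | /of_pair/to_dual].
by split=> [/to_bicross/to_Manin | /to_Manin/to_bicross].
Qed.
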